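(* Let $\mathcal{I}$ be a proper admissible ideal on $\mathbb{N}$. The space $2^{\omega_1}$ contains a countable dense $\mathcal{I}$-H-separable subspace.
   Context: An ideal on $\mathbb{N}$ is a family of subsets of $\mathbb{N}$ closed under finite unions and under subsets; it is admissible if it contains every singleton and proper if it does not contain $\mathbb{N}$. $2^{\omega_1}$ is the product of $\omega_1$ copies of the discrete space $2=\{0,1\}$. A space $X$ is $\mathcal{I}$-H-separable if for every sequence $(Y_n)_{n\in\mathbb{N}}$ of dense subspaces of $X$ there is a sequence $(F_n)_{n\in\mathbb{N}}$ such that each $F_n$ is a finite subset of $Y_n$ and for every nonempty open set $U$ of $X$, $\{n\in\mathbb{N} : U\cap F_n=\emptyset\}\in\mathcal{I}$. *)

(* Defs.v *)
From mathcomp Require Import all_boot.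
From mathcomp Require Import boolp classical_sets functions cardinality.
From mathcomp Require Import wochoice topology.

Set Implicit Arguments.
Unset Strict Implicit.
Unset Printing Implicit Defensive.

Local Open Scope classical_set_scope.

Definition is_ideal (I : set (set nat)) : Prop :=
  [/\ I set0,
      forall A B, I A -> I B -> I (A `|` B)
    & forall A B, A `<=` B -> I B -> I A].

Definition admissible (I : set (set nat)) : Prop := forall n, I [set n].

Definition proper_ideal (I : set (set nat)) : Prop := ~ I [set: nat].

(* Density of the [Y n] is density in [X] itself; to speak of a subspace
   [D : set X], use the type [set_type D], which carries the subspace topology
   (the type [subspace D] of the library does not: it keeps all the points of
   [X] and isolates those outside [D]). *)
Definition I_H_separable (I : set (set nat)) (X : topologicalType) : Prop :=
  forall Y : nat -> set X, (forall n, dense (Y n)) ->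
  exists F : nat -> set X,
    (forall n, finite_set (F n) /\ F n `<=` Y n) /\
    forall U : set X, open U -> U !=set0 -> I [set n | U `&` F n = set0].

(* [le] is the (reflexive) order of a well-order of type omega_1: an
   uncountable well-order all of whose proper initial segments are countable.
   Such a well-order is unique up to isomorphism, and exists by
   [omega1_order_exists]. *)
Definition omega1_order (W : Type) (le : rel W) : Prop :=
  [/\ well_order le,
      ~ countable [set: W]
    & forall x, countable [set y | le y x /\ y <> x]].

Lemma uncountable_set_nat : ~ countable [set: set nat].
Proof.
move=> /countable_injP[f finj].
pose D := [set n | exists2 A : set nat, f A = n & ~ A n].
have nD : ~ D (f D).
  move=> /[dup] DfD [A fA nA]; apply: nA.
  by have <- : D = A by apply: finj; rewrite ?in_setT.
by apply: (nD); exists D.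
Qed.

Lemma omega1_order_exists : exists (W : Type) (le : rel W), omega1_order le.
Proof.
have [le lewo] := well_ordering_principle (set nat : eqType).
pose seg x : set (set nat) := [set y | le y x /\ y <> x].
have [segc | /existsNP[x0 x0P]] := pselect (forall x, countable (seg x)).
  by exists (set nat), le; split=> //; exact: uncountable_set_nat.
have [|x [[xP xmin] _]] := lewo [pred x | `[< ~ countable (seg x) >]].
  by exists x0; apply/asboolP.
have {xP}/asboolP xP := xP.
pose W := set_type (seg x); pose leW : rel W := fun u v => le (val u) (val v).
have lewoc : wo_chain le predT by move=> A _; exact: lewo.
have le_anti u v : le u v -> le v u -> u = v.
  move=> uv vu; apply: (wo_chain_antisymmetric lewoc); rewrite ?inE//.
  by rewrite uv.
exists W, leW; split.
- apply: antisymmetric_well_order => [u v /andP[uv vu]|A [a aA]].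
    by apply: val_inj; exact: le_anti.
  have [|z [[zP zmin] _]] := lewo [pred y | `[< exists2 u, u \in A & val u = y >]].
    by exists (val a); apply/asboolP; exists a.
  have {zP}/asboolP[u uA uz] := zP; exists u; split=> // v vA.
  by rewrite /leW uz; apply: zmin; apply/asboolP; exists v.
- move=> Wc; apply: xP; rewrite /countable.
  by rewrite -(card_le_eql (card_setT (seg x))).
- move=> u; have segu : countable (seg (val u)).
    apply: contrapT => nc; have /set_mem[ux ux'] := valP u.
    by apply/ux'/le_anti => //; apply: xmin; apply/asboolP.
  have val_inj_in : {in [set v | leW v u /\ v <> u] &, injective (val : W -> set nat)}.
    by move=> ? ? _ _; exact: val_inj.
  rewrite -(eq_countable (inj_card_eq val_inj_in)).
  apply: sub_countable segu; apply: subset_card_le => _ [v [vu vu'] <-].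
  by split=> // /val_inj.
Qed.

(* Main.v *)
Require Import Defs.
From mathcomp Require Import all_boot.
From mathcomp Require Import mathcomp_extra boolp classical_sets functions.
From mathcomp Require Import cardinality.
From mathcomp Require Import wochoice topology.

Set Implicit Arguments.
Unset Strict Implicit.
Unset Printing Implicit Defensive.

Local Open Scope classical_set_scope.

(** An admissible ideal contains every finite set, so it is enough to produce
a countable dense D such that the finite sets F n can be chosen to meet each
nonempty open set for all but finitely many n.

Let x be an injection of W, of type omega_1, into the Cantor space, and let D
consist of the traces on W of the clopen subsets of the Cantor space: D is
countable, and it is dense because clopen sets separate points
([trace_dense]). A basic open set of D is given by a condition e, a finite
list of prescribed values. If Y n is dense, every condition that D realizes is
met by an element of Y n, and the least index of such an element defines a
function of n. A choice of finite sets F n amounts to a single function that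
eventually bounds all those functions: the conditions are then called
captured. Countable unions of captured families are captured
([captured_bigcup]), so the length of the condition can be fixed, and an
induction on the length starts.

If every family of functions nat -> nat indexed by W has an eventual bound, the
induction step is one application of this bound ([dominated_captured]).

Otherwise W indexes an unbounded family f, and there is a family G above f that
increases along W for eventual domination ([scale_exists]). Let x w be the
orbit of 0 under G w, except on a countable set of indices where x runs through
the finite sets. For every H : nat -> nat, an infinite set J and a countable
set C can be found such that, for w outside C and almost all n in J, the set
x w has at most one element in [n, H n). Indeed some f w0 exceeds H on an
infinite set J; so does G w almost everywhere on J when w is above w0, and two
elements a < b of the orbit x w with n <= a satisfy G w n <= b.

The space of these points is a Hurewicz space in all finite powers, and the
proof of this fact captures the conditions of length r. Given n, replace each
point of a condition by its trace below n. Only finitely many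
conditions result, each is met in Y k by a clopen set that looks at finitely
many coordinates, and so there is h such that the original condition is met as
well as soon as its points have no element in [n, h)
([truncation_captured]). Iterating h from n gives r + 1 consecutive intervals;
r points with at most one element each in their union miss one of the
intervals completely ([gap_pigeonhole]). This captures the conditions whose
points avoid C ([generic_captured]). The others prescribe a value at a point
of the countable set C; fixing this value leaves a condition of smaller length
([sparse_captured]). *)

(** * Basic open sets of a power of the two-point space *)

Definition agrees (W : Type) (q : W -> bool) (e : seq (W * bool)) : bool :=
  all (fun u => q u.1 == u.2) e.

Lemma open_agrees (W : choiceType) (e : seq (W * bool)) :
  open [set q : {ptws W -> bool} | agrees q e].
Proof.
elim: e => [|[w b] e IH].
  have -> : [set q : {ptws W -> bool} | agrees q [::]] = setT.
    by apply/seteqP; split.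
  exact: openT.
have -> : [set q : {ptws W -> bool} | agrees q ((w, b) :: e)] =
    (@proj W (fun=> bool) w : {ptws W -> bool} -> bool) @^-1` [set b] `&`
    [set q | agrees q e].
  apply/seteqP; split=> q; rewrite /agrees /=; first by move=> /andP[/eqP].
  by rewrite /proj => -[-> ->]; rewrite eqxx.
apply: openI => //; apply: open_comp; last exact: discrete_open.
by move=> q _; exact: (@proj_continuous W (fun=> bool) w q).
Qed.

Lemma nbhs_agrees (W : Type) (p : {ptws W -> bool}) (U : set {ptws W -> bool}) :
  nbhs p U -> exists2 e, agrees p e & forall q, agrees q e -> U q.
Proof.
pose F : set_system {ptws W -> bool} :=
  [set V | exists2 e, agrees p e & forall q, agrees q e -> V q].
have FF : Filter F.
  constructor.
  - by exists [::].
  - move=> A B [e pe eA] [e' pe' eB]; exists (e ++ e').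
      by rewrite /agrees all_cat; apply/andP.
    move=> q; rewrite /agrees all_cat => /andP[qe qe'].
    by split; [apply: eA|apply: eB].
  - by move=> A B AB [e pe eA]; exists e => // q qe; apply/AB/eA.
suff : F --> p by apply.
apply/cvg_sup => w V.
rewrite (@nbhsE (initial_topology (fun f : W -> bool => f w))).
move=> [B [[O oO <-] /= Opw] BV].
exists [:: (w, p w)]; first by rewrite /agrees /= eqxx.
by move=> q; rewrite /agrees /= andbT => /eqP qw; apply: BV => /=; rewrite qw.
Qed.

(** * Eventual domination and captured families *)

Definition dominated (T : Type) (f : T -> nat -> nat) :=
  exists g, forall t, \forall n \near \oo, f t n <= g n.

(** Diagonal argument: the bound at n takes into account only the functions of
rank at most n in an enumeration. *)
Lemma countable_dominated (T : Type) (E : set T) (f : T -> nat -> nat) :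
  countable E ->
  exists g, forall t, E t -> \forall n \near \oo, f t n <= g n.
Proof.
move=> /countable_injP[i iinj].
have [h hP] : {h : nat -> nat -> nat & forall k t, E t -> i t = k -> h k = f t}.
  apply: (choice (P := fun k h => forall t, E t -> i t = k -> h = f t)) => k.
  have [[t [Et itk]]|nE] := pselect (exists t, E t /\ i t = k).
    exists (f t) => s Es isk; congr f; apply: iinj; rewrite ?in_setE//.
    by rewrite itk isk.
  by exists (fun=> 0) => t Et itk; case: nE; exists t.
exists (fun n => \max_(k < n.+1) h k n) => t Et.
exists (i t) => // n /= itn.
by rewrite -(hP (i t))//; apply: (leq_bigmax (Ordinal (itn : i t < n.+1))).
Qed.

(** The intended reading of [hit n j e] is that an element of rank at most j of
the n-th set meets the condition e. *)
Definition captured (T : Type) (hit : nat -> nat -> T -> Prop) (E : set T) :=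
  exists g : nat -> nat,
    forall e, E e -> \forall n \near \oo, hit n (g n) e.

(** A countable family of functions has an eventual bound, so the bounds of the
members of the union have one. *)
Lemma captured_bigcup (T K : Type) (hit : nat -> nat -> T -> Prop)
    (A : set K) (E : K -> set T) :
  (forall n i j e, i <= j -> hit n i e -> hit n j e) -> countable A ->
  (forall k, A k -> captured hit (E k)) ->
  captured hit (\bigcup_(k in A) E k).
Proof.
move=> hitS Ac EA.
have [G GP] : {G : K -> nat -> nat & forall k, A k ->
    forall e, E k e -> \forall n \near \oo, hit n (G k n) e}.
  apply: (choice (P := fun k g => A k -> forall e, E k e ->
    \forall n \near \oo, hit n (g n) e)) => k.
  have [/EA[g gP]|nAk] := pselect (A k); first by exists g.
  by exists id.
have [g gP] := countable_dominated G Ac; exists g => e [k Ak Eke].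
near=> n; apply: (hitS _ (G k n)); near: n; first exact: gP.
exact: GP.
Unshelve. all: by end_near. Qed.

Lemma captured1 (T : Type) (hit : nat -> nat -> T -> Prop) (e : T) :
  (forall n, exists j, hit n j e) -> captured hit [set e].
Proof.
by move=> /choice[g gP]; exists g => _ ->; exists 0.
Qed.

(** * Traces of clopen subsets of the Cantor space *)

(** The code (m, s) stands for the union of the cylinders given by the words of
length m in s. *)
Definition clopen_code := (nat * seq (seq bool))%type.

Definition clopen_of (c : clopen_code) (y : nat -> bool) : bool :=
  mkseq y c.1 \in c.2.

Lemma clopen_of_local (c : clopen_code) (y z : nat -> bool) :
  (forall i, i < c.1 -> y i = z i) -> clopen_of c y = clopen_of c z.
Proof.
move=> yz; rewrite /clopen_of; have -> // : mkseq y c.1 = mkseq z c.1.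
by apply/eq_in_map => i; rewrite mem_iota => /yz.
Qed.

Definition trace (W : Type) (x : W -> nat -> bool) (c : clopen_code) (w : W) :=
  clopen_of c (x w).

(** Finitely many distinct points are already distinguished by their first m
values for some m. *)
Lemma separating_level (W : choiceType) (x : W -> nat -> bool) (s : seq W) :
  injective x ->
  exists m, {in s &, forall v w, mkseq (x v) m = mkseq (x w) m -> v = w}.
Proof.
move=> xinj.
have [i iP] : {i : W * W -> nat &
    forall p, x p.1 (i p) = x p.2 (i p) -> p.1 = p.2}.
  apply: (choice (P := fun p i => x p.1 i = x p.2 i -> p.1 = p.2)) => -[v w] /=.
  have [->|vw] := eqVneq v w; first by exists 0.
  apply: contrapT => /forallNP H; move/eqP: vw; apply; apply/xinj/funext => i.
  by apply: contrapT => xi; apply: (H i) => /xi.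
exists (\max_(p <- [seq (v, w) | v <- s, w <- s]) (i p).+1) => v w vs ws xvw.
apply: (iP (v, w)) => /=; set k := i _.
have km : k < \max_(p <- [seq (v, w) | v <- s, w <- s]) (i p).+1.
  by apply: (leq_bigmax_seq (F := fun p => (i p).+1)) => //; apply: allpairs_f.
by rewrite -(nth_mkseq false (x v) km) xvw nth_mkseq.
Qed.

Lemma trace_dense (W : choiceType) (x : W -> nat -> bool)
    (q : W -> bool) (e : seq (W * bool)) :
  injective x -> agrees q e -> exists c, agrees (trace x c) e.
Proof.
move=> xinj /allP qe; have [m mP] := separating_level (unzip1 e) xinj.
exists (m, [seq mkseq (x w) m | w <- unzip1 e & q w]).
apply/allP => -[w b] we /=; have /eqP/= <- := qe _ we.
have ws : w \in unzip1 e by apply/mapP; exists (w, b).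
apply/eqP; rewrite /trace /clopen_of /=.
have [qw|nqw] := boolP (q w).
  by apply/mapP; exists w => //; rewrite mem_filter qw.
apply/negbTE/mapP => -[v]; rewrite mem_filter => /andP[qv vs] wv.
by rewrite (mP w v)// qv in nqw.
Qed.

(** * Capturing the realized conditions *)

Section Capture.
Variables (W : choiceType) (x : W -> nat -> bool) (Z : nat -> set clopen_code).

Definition realized (e : seq (W * bool)) := exists c, agrees (trace x c) e.

(** This is how the density of the n-th set is used. *)
Hypothesis Z_dense : forall n e, realized e ->
  exists2 c, Z n c & agrees (trace x c) e.

Definition hit (n j : nat) (e : seq (W * bool)) :=
  exists c, [/\ pickle c <= j, Z n c & agrees (trace x c) e].

Lemma hitS n i j e : i <= j -> hit n i e -> hit n j e.
Proof.
by move=> ij [c [ci Zc ce]]; exists c; split=> //; exact: leq_trans ij.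
Qed.

(** The prefix t holds the values that an induction on r has already fixed. *)
Definition extensions (t : seq (W * bool)) (r : nat) : set (seq (W * bool)) :=
  [set u | realized u /\ exists2 e, size e = r & u = t ++ e].

Lemma extensions0_captured t : captured hit (extensions t 0).
Proof.
have [rt|nrt] := pselect (realized t).
  have [n|g gP] := @captured1 _ hit t.
    by have [c Zc ct] := Z_dense n rt; exists (pickle c), c.
  by exists g => u [_ [e /size0nil -> ->]]; rewrite cats0; apply: gP.
by exists id => u [ru [e /size0nil e0 uE]]; rewrite uE e0 cats0 in ru.
Qed.

(** The first pair (w, b) of a condition ranges over an index set of the size of
W, and by induction each choice of it comes with its own bound: the hypothesis
bounds all these bounds at once. *)
Lemma dominated_captured :
  (forall f : W -> nat -> nat, dominated f) ->
  forall r t, captured hit (extensions t r).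
Proof.
move=> dom; elim=> [|r IH] t; first exact: extensions0_captured.
have [G GP] := choice (fun u => IH (rcons t u)).
have [g gP] := dom (fun w n => maxn (G (w, true) n) (G (w, false) n)).
exists g => u [ru [[|[w b] e]//= [er] uE]]; rewrite uE -cat_rcons in ru *.
near=> n; apply: (@hitS _ (G (w, b) n)).
  have : maxn (G (w, true) n) (G (w, false) n) <= g n by near: n; exact: gP.
  by apply: leq_trans; case: (b); rewrite leq_max leqnn ?orbT.
by near: n; apply: GP; split=> //; exists e.
Unshelve. all: by end_near. Qed.

Hypothesis x_finite : forall s : seq bool,
  exists w, forall i, x w i = nth false s i.

(** The points of the condition are replaced by their traces below n, which are
finite sets and hence points of the space. This leaves finitely many
conditions; h bounds the number of coordinates seen by the clopen sets chosen
for them, and j bounds the indices of these sets. A point without element in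
[n, h) cannot be distinguished from its truncation by these clopen sets. The
bound on c.1 makes the truncated condition realized too. *)
Lemma truncation_captured r t n : exists h j, forall e, size e = r ->
  (exists2 c, c.1 <= n & agrees (trace x c) (t ++ e)) ->
  all (fun u => [forall i : 'I_h, (n <= i) ==> ~~ x u.1 i]) e ->
  forall k, k <= n -> hit k j (t ++ e).
Proof.
have [V VP] := choice x_finite.
pose pat := (r.-tuple (n.-tuple bool * bool))%type.
pose lst (p : pat) : seq (W * bool) :=
  t ++ [seq (V (tval u.1), u.2) | u <- tval p].
have [c cP] : {c : 'I_n.+1 * pat -> clopen_code &
    forall kp : 'I_n.+1 * pat, realized (lst kp.2) ->
    Z kp.1 (c kp) /\ agrees (trace x (c kp)) (lst kp.2)}.
  apply: (choice (P := fun (kp : 'I_n.+1 * pat) c => realized (lst kp.2) ->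
    Z kp.1 c /\ agrees (trace x c) (lst kp.2))) => kp.
  have [/(Z_dense kp.1)[c Zc cl]|nr] := pselect (realized (lst kp.2)).
    by exists c.
  by exists (0, [::]).
exists (\max_kp (c kp).1), (\max_kp pickle (c kp)).
move=> e er [c0 c0n c0e] /allP gap k kn.
have patP : size [seq (mktuple (fun i : 'I_n => x u.1 i), u.2) | u <- e] == r.
  by rewrite size_map er.
(* the pattern p records the first n values of each point of e *)
pose p : pat := Tuple patP.
have lstE : lst p = t ++ [seq (V (mkseq (x u.1) n), u.2) | u <- e].
  congr (_ ++ _); rewrite /= -map_comp; apply: eq_map => u /=; congr (V _, _).
  by rewrite /mkseq -val_enum_ord -map_comp.
have xV u i : x (V (mkseq (x u) n)) i = if i < n then x u i else false.
  rewrite VP; case: ltnP => ni; first by rewrite nth_mkseq.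
  by rewrite nth_default// size_mkseq.
pose kp : 'I_n.+1 * pat := (Ordinal (kn : k < n.+1), p).
have /cP[Zc] : realized (lst kp.2).
  exists c0; rewrite lstE /agrees all_cat; move: c0e; rewrite /agrees all_cat.
  move=> /andP[-> /=]; rewrite all_map => /allP c0e; apply/allP => u ue /=.
  rewrite -(eqP (c0e u ue)); apply/eqP/clopen_of_local => i ic.
  by rewrite xV (leq_trans ic c0n).
rewrite lstE /agrees all_cat all_map => /andP[ct /allP ce].
exists (c kp); split=> //.
  exact: (leq_bigmax (F := fun kp => pickle (c kp))).
rewrite /agrees all_cat ct; apply/allP => u ue; have /eqP/= <- := ce u ue.
apply/eqP/clopen_of_local => i ic; rewrite xV; case: ltnP => // ni.
have ih : i < \max_kp (c kp).1.
  by apply: leq_trans ic _; exact: (leq_bigmax (F := fun kp => (c kp).1)).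
by have /forallP/(_ (Ordinal ih))/implyP/(_ ni)/negbTE := gap u ue.
Qed.

(** Otherwise each of the r + 1 intervals [nu i, nu i.+1) contains an element of
one of the r points, so two of these intervals belong to the same point. *)
Lemma gap_pigeonhole (r : nat) (nu : nat -> nat) (e : seq (W * bool)) :
  {homo nu : i j / i <= j} -> size e = r ->
  (forall u, u \in e -> forall a b, nu 0 <= a -> a < b -> x u.1 a -> x u.1 b ->
     nu r.+1 <= b) ->
  exists2 i, i <= r &
    all (fun u => [forall a : 'I_(nu i.+1), (nu i <= a) ==> ~~ x u.1 a]) e.
Proof.
move=> nuh er sp; apply: contrapT => nogap.
have [f fP] : {f : 'I_r.+1 -> 'I_r * nat & forall (i : 'I_r.+1) u0,
    [/\ nu i <= (f i).2, (f i).2 < nu i.+1 & x (nth u0 e (f i).1).1 (f i).2]}.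
  apply: (choice (P := fun (i : 'I_r.+1) (ka : 'I_r * nat) => forall u0,
    [/\ nu i <= ka.2, ka.2 < nu i.+1 & x (nth u0 e ka.1).1 ka.2])) => i.
  have /allPn[u ue] : ~~ all (fun u =>
      [forall a : 'I_(nu i.+1), (nu i <= a) ==> ~~ x u.1 a]) e.
    by apply/negP => H; apply: nogap; exists i => //; rewrite -ltnS.
  move=> /forallPn[a]; rewrite negb_imply negbK => /andP[ia xa].
  have ur : index u e < r by rewrite -er index_mem.
  by exists (Ordinal ur, val a) => u0; split=> //=; rewrite nth_index.
have finj : injective (fun i => (f i).1).
  suff H (i i' : 'I_r.+1) : i < i' -> (f i).1 <> (f i').1.
    move=> i i' ff; apply/val_inj/eqP; rewrite eqn_leq.
    by apply/andP; split; rewrite leqNgt; apply/negP => /H; rewrite ff.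
  move=> ii' ff; have u0 : W * bool.
    by case: (e) er => [/esym r0|u //]; case: (f i) => -[k]; rewrite r0.
  have [ia ai xa] := fP i u0; have [i'a ai' xa'] := fP i' u0.
  have : nu r.+1 <= (f i').2.
    apply: (sp (nth u0 e (f i').1) _ (f i).2) => //.
    - by rewrite mem_nth// er.
    - exact: leq_trans (nuh _ _ (leq0n _)) ia.
    - exact: leq_trans (leq_trans ai (nuh _ _ ii')) i'a.
    - by rewrite -ff.
  by apply/negP; rewrite -ltnNge; apply: leq_trans ai' (nuh _ _ _).
by have := leq_card _ finj; rewrite !card_ord ltnn.
Qed.

(** The form in which the unboundedness of the scale is used: one infinite set J
serves all but countably many points, whereas the place where the condition
sets in depends on the point. *)
Definition sparse := forall H : nat -> nat, exists (J : set nat) (C : set W),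
  [/\ forall k, exists2 n, k <= n & J n,
      countable C
    & forall w, ~ C w -> \forall n \near \oo, J n -> forall a b,
        n <= a -> a < b -> x w a -> x w b -> H n <= b].

(** The bound at k looks ahead to some element n >= k of J: for n in J large
enough, one of the r + 1 intervals obtained by iterating h from n is a gap of
all the points of the condition, and the truncation at its left end, which is
at least k, serves the k-th set. *)
Lemma generic_captured r t : sparse -> exists2 C : set W, countable C &
  captured hit [set u | realized u /\ exists2 e, size e = r /\
    (forall v, v \in e -> ~ C v.1) & u = t ++ e].
Proof.
move=> xsp; have [h hP] := choice (truncation_captured r t).
have {hP}[j hjP] := choice hP.
pose h' n := maxn (h n) n.
have [J [C [Jinf Cc CP]]] := xsp (fun n => iter r.+1 h' n).
exists C => //.
have [nxt nxtP] : {nxt : nat -> nat & forall k, k <= nxt k /\ J (nxt k)}.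
  apply: (choice (P := fun k n => k <= n /\ J n)) => k.
  by have [n kn Jn] := Jinf k; exists n.
exists (fun k => \max_(i < r.+1) j (iter i h' (nxt k))) => u.
move=> [[c0 c0u] [e [er eC] uE]]; rewrite {u}uE in c0u *.
have [N NP] : exists N, forall n, N <= n -> J n -> forall u, u \in e ->
    forall a b, n <= a -> a < b -> x u.1 a -> x u.1 b -> iter r.+1 h' n <= b.
  elim: (e) eC => [|u e' IHe] ueC; first by exists 0.
  have [v ve|N NP] := IHe; first by apply: ueC; rewrite inE ve orbT.
  have [|M _ MP] := CP u.1; first by apply: ueC; rewrite mem_head.
  exists (maxn N M) => n; rewrite geq_max => /andP[Nn Mn] Jn v.
  rewrite inE => /predU1P[->|ve]; first exact: MP.
  exact: NP.
exists (maxn N c0.1) => // k /=; rewrite geq_max => /andP[Nk c0k].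
have [knxt Jk] := nxtP k.
have nuh : {homo (fun i => iter i h' (nxt k)) : i j / i <= j}.
  by apply: homo_leq => [i|i1 i2 i3|i]; [|exact: leq_trans|rewrite leq_maxr].
have [|i ir gap] := @gap_pigeonhole r (fun i => iter i h' (nxt k)) e nuh er.
  by apply: NP => //; exact: leq_trans knxt.
have ki : k <= iter i h' (nxt k) := leq_trans knxt (nuh 0 i (leq0n i)).
apply: (@hitS _ (j (iter i h' (nxt k)))).
  exact: (leq_bigmax (F := fun i : 'I_r.+1 => j (iter i h' (nxt k)))
    (Ordinal (ir : i < r.+1))).
apply: hjP => //; first by exists c0 => //; exact: leq_trans ki.
apply/allP => u /(allP gap)/forallP gapu; apply/forallP => a.
have ah : a < iter i.+1 h' (nxt k) by rewrite /= leq_max ltn_ord.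
exact: (gapu (Ordinal ah)).
Qed.

(** A condition with a point in the exceptional set C becomes shorter once the
value at this point is moved to the fixed prefix, and this can be done in only
countably many ways. *)
Lemma sparse_captured : sparse -> forall r t, captured hit (extensions t r).
Proof.
move=> xsp; elim=> [|r IH] t; first exact: extensions0_captured.
have [C Cc [g gP]] := generic_captured r.+1 t xsp.
have [|u _|g' g'P] := @captured_bigcup _ _ hit
    (C `*` [set: bool]) (fun u => extensions (rcons t u) r) hitS.
- by apply: countableX => //; exact: countableP.
- exact: IH.
exists (fun n => maxn (g n) (g' n)) => u [ru [e er uE]].
have [eC|/existsNP[v /not_implyP[ve /contrapT vC]]] :=
    pselect (forall v, v \in e -> ~ C v.1).
  apply: filterS (gP u _) => [n|]; first by apply: hitS; rewrite leq_maxl.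
  by split=> //; exists e.
case/path.splitPr: ve er uE => e1 e2 er uE.
(* agreement depends only on the set of prescribed values *)
have swap q : agrees q u = agrees q (rcons t v ++ (e1 ++ e2)).
  rewrite uE /agrees -cats1 !all_cat /=.
  by do !case: all => //=; rewrite ?andbF ?andbT.
apply: filterS (g'P (rcons t v ++ (e1 ++ e2)) _) => [n [c [cg Zc cu]]|].
  by exists c; split; rewrite ?swap// (leq_trans cg)// leq_maxr.
exists v => //; split; last first.
  by exists (e1 ++ e2) => //; move: er; rewrite !size_cat /= addnS => -[].
by have [c cu] := ru; exists c; rewrite -swap.
Qed.

End Capture.

(** * Scales along a well-order of type omega_1 *)

Lemma countableU (T : Type) (A B : set T) :
  countable A -> countable B -> countable (A `|` B).
Proof.
move=> Ac Bc; rewrite -bigcup2E; apply: bigcup_countable => //.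
by move=> [|[|n]] _ //=; exact: countable0.
Qed.

Section Scale.
Variables (W : choiceType) (le : rel W).
Hypothesis le_omega1 : omega1_order le.

Definition below (v w : W) := le v w /\ v <> w.

Lemma le_chain : wo_chain le predT.
Proof. by case: le_omega1 => lewo _ _ A _; exact: lewo. Qed.

Lemma below_total v w : v <> w -> below v w \/ below w v.
Proof.
move=> vw; have /orP[|] : le v w || le w v by apply: (wo_chainW le_chain).
  by left.
by right; split=> // /esym.
Qed.

Lemma below_wf : well_founded below.
Proof.
case: le_omega1 => lewo _ _; apply: contrapT => /existsNP[w0 w0P].
have [|z [[zP zmin] _]] := lewo [pred w | `[< ~ Acc below w >]].
  by exists w0; apply/asboolP.
have {zP}/asboolP[] := zP; constructor => v [vz /eqP nvz].
apply: contrapT => /asboolP nv; move/eqP: nvz; apply.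
by apply: (wo_chain_antisymmetric le_chain) => //; rewrite vz zmin.
Qed.

(** Transfinite recursion: initial segments are countable, so at each stage one
function eventually exceeds all the previous ones. *)
Lemma scale_exists (f : W -> nat -> nat) : exists G : W -> nat -> nat,
  [/\ forall w n, f w n <= G w n,
      forall w n, n < G w n,
      forall w, {homo G w : m n / m <= n}
    & forall v w, below v w -> \forall n \near \oo, G v n < G w n].
Proof.
pose spec w (F : forall v, below v w -> nat -> nat) (h : nat -> nat) :=
  [/\ forall n, f w n <= h n, forall n, n < h n, {homo h : m n / m <= n}
    & forall v (vw : below v w), \forall n \near \oo, F v vw n < h n].
have spec_ex w F : exists h, spec w F h.
  case: le_omega1 => _ _ segc.
  pose F' v n := if pselect (below v w) is left vw then F v vw n else 0.
  have [g gP] := countable_dominated F' (segc w).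
  exists (fun n => \sum_(k < n.+1) (g k + f w k).+1).
  have ge n : g n + f w n < \sum_(k < n.+1) (g k + f w k).+1.
    by rewrite big_ord_recr /= leq_addl.
  split.
  - by move=> n; apply: leq_trans (ltnW (ge n)); exact: leq_addl.
  - move=> n; rewrite -[X in X <= _]card_ord -sum1_card; exact: leq_sum.
  - apply: homo_leq => [//|? ? ?|n]; first exact: leq_trans.
    by rewrite [X in _ <= X]big_ord_recr leq_addr.
  - move=> v vw; have := gP v vw; apply: filterS => n; rewrite /F'.
    case: pselect => // vw'; rewrite (Prop_irrelevance vw vw') => Fg.
    by apply: leq_ltn_trans (ge n); rewrite (leq_trans Fg)// leq_addr.
pose step w F := projT1 (cid (spec_ex w F)).
have stepP w F : spec w F (step w F) by rewrite /step; case: cid.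
pose G := Fix below_wf (fun=> nat -> nat) step.
have GE w : G w = step w (fun v _ => G v).
  rewrite /G Fix_eq// => w' F1 F2 F12; congr step.
  by apply: functional_extensionality_dep => v; apply/funext => vw.
have GP w : spec w (fun v _ => G v) (G w) by rewrite [X in spec _ _ X]GE.
exists G; split=> [w|w|w|v w vw].
- by case: (GP w).
- by case: (GP w).
- by case: (GP w).
- by case: (GP w) => _ _ _; apply.
Qed.

(** * The points of the space *)

(** For g increasing, [n, g n) contains at most one element of the orbit: a
faster function gives longer gaps at prescribed places. *)
Definition orbit (g : nat -> nat) (a : nat) : bool :=
  `[< exists k, a = iter k g 0 >].

Lemma orbit_gap (g : nat -> nat) n a b : (forall n, n < g n) ->
  {homo g : m n / m <= n} ->
  n <= a -> a < b -> orbit g a -> orbit g b -> g n <= b.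
Proof.
move=> gt gh na ab /asboolP[i ai] /asboolP[j bj].
have ih : {homo (fun i => iter i g 0) : i j / i <= j}.
  by apply: homo_leq => [//|? ? ?|k]; [exact: leq_trans|exact/ltnW/gt].
have ij : i < j.
  by rewrite ltnNge; apply/negP => /ih; rewrite -ai -bj leqNgt ab.
by apply: leq_trans (gh _ _ na) _; rewrite ai bj; exact: (ih i.+1).
Qed.

Lemma iter_ge (g : nat -> nat) k : (forall n, n < g n) -> k <= iter k g 0.
Proof. by move=> gt; elim: k => // k IH; exact: leq_ltn_trans IH (gt _). Qed.

Lemma orbit_unbounded (g : nat -> nat) n : (forall n, n < g n) ->
  exists2 a, n <= a & orbit g a.
Proof.
by move=> gt; exists (iter n g 0); [exact: iter_ge|apply/asboolP; exists n].
Qed.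

(** In a common orbit, both functions would give the successor of a large
element. *)
Lemma orbit_neq (g h : nat -> nat) :
  (forall n, n < g n) -> (forall n, n < h n) ->
  {homo h : m n / m <= n} ->
  (\forall n \near \oo, g n < h n) -> orbit g <> orbit h.
Proof.
move=> gt ht hh [N _ NP] gh.
have oN : orbit g (iter N g 0) by apply/asboolP; exists N.
have oN1 : orbit g (g (iter N g 0)) by apply/asboolP; exists N.+1.
have := @orbit_gap h _ _ _ ht hh (leqnn _) (gt (iter N g 0)).
rewrite -gh => /(_ oN oN1).
by rewrite leqNgt NP //=; exact: iter_ge.
Qed.

(** The scale is built over an unbounded family if there is one; otherwise any
scale will do, as a way to produce distinct points. *)
Lemma points_exist : exists x : W -> nat -> bool, injective x /\
  ((forall f : W -> nat -> nat, dominated f)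
   \/ (forall s : seq bool, exists w, forall i, x w i = nth false s i) /\
      sparse x).
Proof.
have [_ W_uncountable segc] := le_omega1.
have [i iinj] : exists i : nat -> W, injective i.
  have /infiniteP/card_leP[/= i] : infinite_set [set: W].
    by move=> /finite_set_countable.
  exists (fun n => val (i (SigSub (mem_set (I : [set: nat] n))))).
  by move=> m n /val_inj /inj; rewrite !in_setE => /(_ I I)/(congr1 val).
have [f fP] : exists f : W -> nat -> nat,
    dominated f -> forall f : W -> nat -> nat, dominated f.
  have [dom|/existsNP[f fP]] :=
      pselect (forall f : W -> nat -> nat, dominated f).
    by exists (fun _ _ => 0).
  by exists f => /fP.
have [G [fG Ggt Gh Glt]] := scale_exists f.
(* finite sets are represented by increasing lists so that x is injective *)
pose code w (s : seq nat) := sorted ltn s /\ w = i (pickle s).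
pose x w := if pselect (exists s, code w s) is left p
  then fun n => n \in projT1 (cid p) else orbit (G w).
have xN w : ~ (exists s, code w s) -> x w = orbit (G w).
  by rewrite /x; case: pselect.
have xF s : sorted ltn s -> x (i (pickle s)) = fun n => n \in s.
  move=> ss; rewrite /x; case: pselect => [p|[]]; last by exists s.
  by case: cid => s' [_] /= /iinj/(pcan_inj pickleK) ->.
have xN_neq v w : v <> w -> orbit (G v) <> orbit (G w).
  move=> /below_total[/Glt|/Glt] GG; last apply: nesym; exact: orbit_neq GG.
have mem_neq (s : seq nat) w : (fun n => n \in s) <> orbit (G w).
  move=> sE; have [a sa] := orbit_unbounded (\max_(k <- s) k).+1 (Ggt w).
  rewrite -sE => sa'; have := @leq_bigmax_seq _ s xpredT id a sa' isT.
  by rewrite leqNgt sa.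
have xinj : injective x.
  move=> v w.
  have [[s [ss ->]]|/xN ->] := pselect (exists s, code v s);
    have [[s' [ss' ->]]|/xN ->] := pselect (exists s, code w s);
    rewrite ?xF//.
  - move=> ss'E; congr (i (pickle _)).
    apply: (irr_sorted_eq ltn_trans ltnn ss ss') => n.
    by have := congr1 (@^~ n) ss'E.
  - by move/mem_neq.
  - by move/esym/mem_neq.
  - by move=> GG; apply: contrapT => /xN_neq.
exists x; split => //.
have [dom|ndom] := pselect (dominated f).
  by left; exact: fP.
right; split.
  move=> s; exists (i (pickle [seq k <- iota 0 (size s) | nth false s k])) => k.
  rewrite xF; last exact: sorted_filter ltn_trans _ _ (iota_ltn_sorted _ _).
  apply/idP/idP => [/=|sk].
    by rewrite mem_filter => /andP[].
  rewrite /= mem_filter sk mem_iota /=; case: ltnP sk => // ks.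
  by rewrite nth_default.
move=> H; have /existsNP[w0 w0P] :
    ~ (forall w, \forall n \near \oo, f w n <= H n).
  by move=> fH; apply: ndom; exists H.
exists [set n | H n < f w0 n].
exists ([set v | le v w0 /\ v <> w0] `|` [set w0] `|` range i).
split.
- move=> k; apply: contrapT => nk; apply: w0P; exists k => // n /= kn.
  by rewrite leqNgt; apply/negP => fn; apply: nk; exists n.
- apply: countableU; first by apply: countableU.
  by apply: sub_countable (card_image_le _ _) _; exact: countableP.
- move=> w /not_orP[/not_orP[nlt nw0] nran].
  have xw : x w = orbit (G w).
    by apply: xN => -[s [_ wE]]; apply: nran; exists (pickle s).
  have /Glt : below w0 w by have [] := below_total nw0.
  apply: filterS => n GG Hf a b na ab; rewrite xw => oa ob.
  apply: leq_trans (orbit_gap (Ggt w) (Gh w) na ab oa ob).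
  exact/ltnW/(leq_ltn_trans _ GG)/(leq_trans (ltnW Hf)).
Qed.
End Scale.

(** * From capture to I-H-separability *)

Lemma ideal_eventually_not (I : set (set nat)) (A : set nat) :
  is_ideal I -> admissible I ->
  (\forall n \near \oo, ~ A n) -> I A.
Proof.
move=> [I0 IU Isub] Iadm [N _ NP].
have IN m : I [set n | n < m].
  elim: m => [|m IH]; first by apply: Isub I0 => n.
  apply: Isub (IU _ _ IH (Iadm m)) => n /=.
  by rewrite ltnS leq_eqVlt => /predU1P[->|]; [right|left].
by apply: Isub (IN N) => n An; rewrite /= ltnNge; apply/negP => /NP.
Qed.

(** The subspace is indexed by the codes, so that a bound on the rank of the codes
determines a finite set of points. *)
Lemma H_separable_traces (W : choiceType) (x : W -> nat -> bool)
    (I : set (set nat)) :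
  is_ideal I -> admissible I ->
  (forall Z : nat -> set clopen_code,
    (forall n e, realized x e -> exists2 c, Z n c & agrees (trace x c) e) ->
    captured (hit x Z) [set e | realized x e]) ->
  I_H_separable I (set_type (range (trace x) : set {ptws W -> bool})).
Proof.
move=> Iid Iadm cap Y Yd.
pose X : topologicalType := set_type (range (trace x) : set {ptws W -> bool}).
pose Z n : set clopen_code :=
  [set c | exists2 y : X, Y n y & val y = trace x c].
have [n e [c ce]|g gP] := cap Z.
  pose U : set X := [set y : X | agrees (val y) e].
  have Uo : open U.
    by exists [set q : {ptws W -> bool} | agrees q e] => //; exact: open_agrees.
  have U0 : U !=set0.
    by exists (SigSub (mem_set (imageT (trace x) c))).
  have [y [Uy Yy]] := Yd n U U0 Uo.
  have /set_mem[c' _ c'y] := valP y.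
  by exists c'; [exists y|rewrite c'y].
exists (fun n => [set y | Y n y /\
  exists2 c, pickle c <= g n & val y = trace x c]).
split.
  move=> n; split; last by move=> y [].
  have fin : finite_set [set c : clopen_code | pickle c <= g n].
    apply: (@finite_preimage _ _ (`I_(g n).+1) pickle).
      by move=> ? ? _ _; exact: (pcan_inj pickleK).
    exact: finite_II.
  apply: (@sub_finite_set _ _ ((val : X -> W -> bool) @^-1`
    (trace x @` [set c | pickle c <= g n]))).
    by move=> y [_ [c cg yc]]; exists c.
  by apply: finite_preimage (finite_image _ fin) => y z _ _; exact: val_inj.
move=> U [O oO OU] [y0 Uy0]; apply: ideal_eventually_not => //.
have /set_mem[c0 _ c0y] := valP y0.
have [e y0e eO] : exists2 e, agrees (val y0) e & forall q, agrees q e -> O q.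
  apply: nbhs_agrees; apply: open_nbhs_nbhs; split=> //.
  by move: Uy0; rewrite -OU.
have : realized x e by exists c0; rewrite c0y.
move/gP; apply: filterS => n [c [cg [y Yy yc] ce]] /eqP; apply/negP/set0P.
exists y; split.
  by rewrite -OU; apply: eO; rewrite -[set_val y]/(val y) yc.
by split=> //; exists c.
Qed.

Lemma omega1_I_H_separable (I : set (set nat))
    (I_ideal : is_ideal I) (I_adm : admissible I)
    (W : choiceType) (le : rel W) (W_omega1 : omega1_order le) :
  exists D : set {ptws W -> bool},
    [/\ countable D, dense D & I_H_separable I (set_type D)].
Proof.
have [x [xinj xP]] := points_exist W_omega1.
exists (range (trace x)); split.
- by apply: sub_countable (card_image_le _ _) _; exact: countableP.
- move=> O [p Op] oO.
  have [|e pe eO] := @nbhs_agrees W p O; first exact: open_nbhs_nbhs.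
  have [c ce] := trace_dense xinj pe.
  by exists (trace x c); split; [exact: eO|exists c].
- apply: H_separable_traces => // Z Zd.
  have capr r : captured (hit x Z) (extensions x [::] r).
    case: xP => [dom|[xfin xsp]]; first exact: dominated_captured.
    exact: sparse_captured.
  have [||g gP] := @captured_bigcup _ _ (hit x Z) [set: nat]
    (extensions x [::]) (@hitS _ x Z).
  - exact: countableP.
  - by move=> r _; exact: capr.
  - exists g => e re; apply: gP; exists (size e) => //; split=> //.
    by exists e.
Qed.

Theorem corollary3p25 (I : set (set nat))
    (I_ideal : is_ideal I) (I_adm : admissible I) (I_proper : proper_ideal I)
    (W : Type) (le : rel W) (W_omega1 : omega1_order le) :
  exists D : set {ptws W -> bool},
    [/\ countable D, dense D & I_H_separable I (set_type D)].
Proof.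
exact: (@omega1_I_H_separable I I_ideal I_adm {classic W} le W_omega1).
Qed.
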